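(* The values of $w_{\mathfrak{gl}}$ and $w_{\mathfrak{so}}$ on a permutation depend only on the cyclic order on the set of permuted elements. In other words, for every $m\ge1$ and every $s\in S(m)$, if $c\in S(m)$ denotes the cyclic permutation $1\mapsto2\mapsto\dots\mapsto m\mapsto1$, then $$w_{\mathfrak{gl}}(c\,s\,c^{-1})=w_{\mathfrak{gl}}(s),\qquad w_{\mathfrak{so}}(c\,s\,c^{-1})=w_{\mathfrak{so}}(s).$$
   Context: **Permutations.** $S(m)$ is the symmetric group on $\{1,\dots,m\}$ ($S(0)$ has one element, the empty permutation). A permutation of a finite totally ordered set $X$ is identified with an element of $S(|X|)$ via the order-preserving bijection $X\to\{1,\dots,|X|\}$. A cycle $(x_1\,x_2\dots x_\ell)$ means $x_1\mapsto x_2\mapsto\dots\mapsto x_\ell\mapsto x_1$. The concatenation of $s\in S(m)$ and $t\in S(n)$ is the permutation in $S(m+n)$ acting as $s$ on $\{1,\dots,m\}$ and as $t$ (shifted by $m$) on $\{m+1,\dots,m+n\}$. For a finite word $Q$ in distinct letters, $|Q|$ is its length and $\overline{Q}$ is the reversed word; juxtaposition of words is concatenation; words may be empty. **Notation for recurrences.** Let $s\in S(m)$ and $1\le r<m$. Let $s'$ be the conjugate of $s$ by the transposition $(r\ r{+}1)$. Let $V$ be a new letter, and order $(\{1,\dots,m\}\setminus\{r,r+1\})\cup\{V\}$ so that $V$ occupies the place of $r,r+1$. For a collection $d$ of cycles in the letters of the cycles of $s$ through $r$ and $r+1$, with $r,r+1$ deleted and $V$ added, let $w[d]$ be the value of $w$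 on the permutation of this ordered set whose cycles are those in $d$ together with all cycles of $s$ containing neither $r$ nor $r+1$. If an empty cycle occurs in $d$, it is interpreted as a factor $C_0$ (i.e. $w[d]$ is $C_0$ times the value obtained by omitting the empty cycle). **The function $w_{\mathfrak{gl}}$.** It is the (known to exist and unique) function on all permutations with values in $\mathbb{C}[C_0,C_1,C_2,\dots]$ such that: - it is multiplicative with respect to concatenation and equals $1$ on the empty permutation; - for every $m\ge1$ its value on the standard cycle $1\mapsto2\mapsto\dots\mapsto m\mapsto1$ is $C_m$; - (Recurrence Rule, $w=w_{\mathfrak{gl}}$) for all $s\in S(m)$, $1\le r<m$: if $r,r+1$ lie in different cycles $(r\,P)$, $(r{+}1\;Q)$ of $s$, then $w(s)=w(s')+w[(V\,Q\,P)]-w[(V\,P\,Q)]$; if they lie in the same cycle $(r\,P\;r{+}1\;Q)$, then $w(s)=w(s')+w[(P)(V\,Q)]-w[(V\,P)(Q)]$. Here $P,Q$ may be empty. **The function $w_{\mathfrak{so}}$.** It is the (existing and unique) function on all permutations with values in $\mathbb{C}[C_0,C_2,C_4,\dots]$ such that: - it is multiplicative with respect to concatenation and equals $1$ on the empty permutation; - if $s'$ is obtained from $s$ by inverting one of its cycles, of length $\ell$, then $w_{\mathfrak{so}}(s')=(-1)^{\ell}w_{\mathfrak{so}}(s)$; - for even $m\ge2$ its value on the standard cycle $1\mapsto2\mapsto\dots\mapsto m\mapsto1$ is $C_m$; - (Recurrence Rule, $w=w_{\mathfrak{so}}$) for all $s\in S(m)$, $1\le r<m$: (a) if $r,r+1$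 lie in different cycles $(r\,P)$, $(r{+}1\;Q)$ ($P,Q$ possibly empty) and $a=|Q|$, then $$w(s)=w(s')+w[(V\,Q\,P)]-w[(V\,P\,Q)]+(-1)^{a}\bigl(w[(V\,P\,\overline{Q})]-w[(V\,\overline{Q}\,P)]\bigr);$$ (b) if they lie in the same cycle $(r\,P\;r{+}1\;Q)$ with $Q$ nonempty and $a=|Q|$, then $$w(s)=w(s')+w[(P)(V\,Q)]-w[(V\,P)(Q)]+(-1)^{a}\bigl(w[(V\,P\,\overline{Q})]+w[(V\,\overline{Q}\,P)]\bigr);$$ (c) if $s(r+1)=r$, i.e. the cycle is $(r\,P\;r{+}1)$, then $w(s)=w(s')+(2-C_0)\,w[(V\,P)]$. *)

(* Defs.v *)
From mathcomp Require Import all_boot all_order all_fingroup all_algebra.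
From mathcomp Require Import reals complex.
From mathcomp Require Import monalg.

Set Implicit Arguments.
Unset Strict Implicit.
Unset Printing Implicit Defensive.

Import GRing.Theory.
Local Open Scope ring_scope.

(* Permuted elements are numbered from 0: 'S_m acts on {0, .., m-1}. *)

Section Permutations.

(* i |-> i + 1 mod m *)
Definition std_cycle (m : nat) : 'S_m := perm (bij_inj (@ordS_bij m)).

Definition concat_fun (m n : nat) (s : 'S_m) (t : 'S_n) (i : 'I_(m + n)) :
    'I_(m + n) :=
  match split i with
  | inl j => lshift n (s j)
  | inr k => rshift m (t k)
  end.

Lemma concat_fun_inj (m n : nat) (s : 'S_m) (t : 'S_n) :
  injective (concat_fun s t).
Proof.
move=> i j; rewrite /concat_fun.
case: (split_ordP i) => a ->; case: (split_ordP j) => b ->.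
- by move/lshift_inj/perm_inj ->.
- by move/eqP; rewrite eq_lrshift.
- by move/eqP; rewrite eq_rlshift.
- by move/rshift_inj/perm_inj ->.
Qed.

Definition concat_perm (m n : nat) (s : 'S_m) (t : 'S_n) : 'S_(m + n) :=
  perm (@concat_fun_inj m n s t).

(* The cycle (x_1 x_2 .. x_l) written as the word [:: x_1; x_2; ..; x_l] of
   distinct letters; [undup] only serves to make the function total. *)
Definition cycle_perm (T : finType) (q : seq T) : {perm T} :=
  perm (can_inj (prev_next (undup_uniq q))).

(* The permutation with cycles ds; these are disjoint in all uses below, so
   that the order of the factors is irrelevant. *)
Definition perm_of_cycles (T : finType) (ds : seq (seq T)) : {perm T} :=
  (\prod_(q <- ds) cycle_perm q)%g.

(* The cycle of s through x, as the word x, s x, s (s x), .. *)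
Definition cycle_word (T : finType) (s : {perm T}) (x : T) : seq T :=
  fingraph.orbit s x.

Definition is_cycle_inversion (m : nat) (s s' : 'S_m) (a : 'I_m) : Prop :=
  forall x, s' x = if x \in porbit s a then (s^-1)%g x else s x.

End Permutations.

Section Recurrence.
Variables (n : nat) (r : 'I_n.+1).

Definition pos0 : 'I_n.+2 := widen_ord (leqnSn n.+1) r.
Definition pos1 : 'I_n.+2 := lift ord0 r.

(* Merging r and r+1 into the single letter V: after order-preserving
   renumbering the new letters are 'I_n.+1 and V is r itself; a letter
   x < r is kept and a letter x > r+1 becomes x-1. *)
Definition merge_letter (x : 'I_n.+2) : 'I_n.+1 := odflt r (unlift pos1 x).

Definition swap_conj (s : 'S_n.+2) : 'S_n.+2 := (s ^ tperm pos0 pos1)%g.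

(* One word (cycle_word s x), x a chosen representative, for each cycle of s
   containing neither r nor r+1 (fixed points included). *)
Definition other_cycles (s : 'S_n.+2) : seq (seq 'I_n.+2) :=
  [seq cycle_word s x | x <- enum 'I_n.+2 &
     [&& froots s x, x \notin cycle_word s pos0 & x \notin cycle_word s pos1]].

(* The words of d are already written in the merged letters. *)
Definition merged_perm (s : 'S_n.+2) (d : seq (seq 'I_n.+1)) : 'S_n.+1 :=
  perm_of_cycles (d ++ [seq map merge_letter q | q <- other_cycles s]).

(* w[d], where every empty cycle of d counts for a factor C_0 *)
Definition bracket (A : comNzRingType) (C0 : A) (w : forall m, 'S_m -> A)
    (s : 'S_n.+2) (d : seq (seq 'I_n.+1)) : A :=
  C0 ^+ count_mem [::] d * w n.+1 (merged_perm s d).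

End Recurrence.

Section Rules.
Variable A : comNzRingType.
Implicit Type w : forall m, 'S_m -> A.

Definition concat_multiplicative w : Prop :=
  w 0%N 1%g = 1 /\
  forall m n (s : 'S_m) (t : 'S_n),
    w (m + n)%N (concat_perm s t) = w m s * w n t.

Definition gl_recurrence (C0 : A) w : Prop :=
  forall n (s : 'S_n.+2) (r : 'I_n.+1) (P Q : seq 'I_n.+2),
  let V := r in
  let p := map (merge_letter r) P in
  let q := map (merge_letter r) Q in
  let W := bracket r C0 w s in
  (pos1 r \notin cycle_word s (pos0 r) ->
   cycle_word s (pos0 r) = pos0 r :: P ->
   cycle_word s (pos1 r) = pos1 r :: Q ->
   w n.+2 s = w n.+2 (swap_conj r s)
              + W [:: V :: q ++ p] - W [:: V :: p ++ q])
  /\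
  (cycle_word s (pos0 r) = pos0 r :: P ++ pos1 r :: Q ->
   w n.+2 s = w n.+2 (swap_conj r s)
              + W [:: p; V :: q] - W [:: V :: p; q]).

Definition so_recurrence (C0 : A) w : Prop :=
  forall n (s : 'S_n.+2) (r : 'I_n.+1) (P Q : seq 'I_n.+2),
  let V := r in
  let p := map (merge_letter r) P in
  let q := map (merge_letter r) Q in
  let a := size Q in
  let W := bracket r C0 w s in
  [/\ pos1 r \notin cycle_word s (pos0 r) ->
      cycle_word s (pos0 r) = pos0 r :: P ->
      cycle_word s (pos1 r) = pos1 r :: Q ->
      w n.+2 s = w n.+2 (swap_conj r s)
                 + W [:: V :: q ++ p] - W [:: V :: p ++ q]
                 + (-1) ^+ a * (W [:: V :: p ++ rev q]
                                - W [:: V :: rev q ++ p]),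
      cycle_word s (pos0 r) = pos0 r :: P ++ pos1 r :: Q ->
      Q != [::] ->
      w n.+2 s = w n.+2 (swap_conj r s)
                 + W [:: p; V :: q] - W [:: V :: p; q]
                 + (-1) ^+ a * (W [:: V :: p ++ rev q]
                                + W [:: V :: rev q ++ p])
    & cycle_word s (pos0 r) = pos0 r :: P ++ [:: pos1 r] ->
      w n.+2 s = w n.+2 (swap_conj r s)
                 + (2%:R - C0) * W [:: V :: p]].

End Rules.

(* The polynomial ring over the complex numbers R[i] in the countably many
   variables X_0, X_1, X_2, .. *)
Definition cpoly (R : realType) : comNzRingType := {malg R[i][{cmonom nat}]}.

Definition cvar (R : realType) (k : nat) : cpoly R := << ucm k >>.

(* Here the variable C_k is X_k. *)
Definition is_w_gl (R : realType) (w : forall m, 'S_m -> cpoly R) : Prop :=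
  [/\ concat_multiplicative w,
      forall m, (1 <= m)%N -> w m (std_cycle m) = cvar R m
    & gl_recurrence (cvar R 0) w].

(* The ring C[C_0, C_2, C_4, ..] has only the even variables: C_(2k) is X_k. *)
Definition is_w_so (R : realType) (w : forall m, 'S_m -> cpoly R) : Prop :=
  [/\ concat_multiplicative w,
      forall m (s s' : 'S_m) (a : 'I_m), is_cycle_inversion s s' a ->
        w m s' = (-1) ^+ #|porbit s a| * w m s,
      forall m, (2 <= m)%N -> ~~ odd m -> w m (std_cycle m) = cvar R m./2
    & so_recurrence (cvar R 0) w].

(* Main.v *)
Require Import Defs.
From mathcomp Require Import all_boot all_order all_fingroup all_algebra.
From mathcomp Require Import reals complex.
From mathcomp Require Import monalg.
From mathcomp Require Import zify.

(** Let the first letter x of s move to the right, past every other letter in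
turn, until it is the last one.  This conjugates s by the inverse of the standard
cycle, and each passage is one application of the recurrence, which contributes a
correction.  The claim is that the corrections add up to zero.

All corrections live on the same ordered set: merging x with the letter y that it
passes leaves the other letters in their original order, with y in its own place.
So let u be s with x struck out of its cycle, and let P be the word such that (x P)
is a cycle of s; thus P is a cycle of u, unless it is empty.

In the gl rule, if y lies in another cycle (y Q), the correction is the value with P
inserted into this cycle just before y, minus the value with P inserted just after
y; inserting after y is inserting before u y.  If y lies in P, the correction is the
value with P cut into two cycles before y, minus the value with P cut after y, that is
cyclically before u y: a cut before the first letter of P or after its last letter
gives the same pieces, P and an empty one.  In both cases the correction is
F y - F (u y) for one function F ([gl_potential]; see [split_bracket] and
[join_bracket]), and the sum over all y vanishes because u is a bijection
([cyclic_invariance]).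

The additional terms of the so rule are of the same form G y - G (u y)
([so_potential]).  If y lies in another cycle, inverting the merged cycle turns them
into the gl terms for the reversed word of P, with a sign depending on the length of P
only ([join_extra]).  If y lies in P, they involve P with a final segment reversed,
starting at y or just after y, with alternating signs; from the last letter of P
back to the first, the sum closes up because inverting the whole of P multiplies the
value by the sign of its length ([split_extra]).  The special rule for s y = x falls
under the same scheme, since a permutation with a fixed point has value zero
([split_last]). *)

Set Implicit Arguments.
Unset Strict Implicit.
Unset Printing Implicit Defensive.

Import GRing.Theory.

(** * Words, orbits and cycles *)

Lemma mem_split (T : eqType) (x : T) (p : seq T) :
  x \in p -> exists p1 p2, p = p1 ++ x :: p2.
Proof. by case/path.splitPr => p1 p2; exists p1, p2. Qed.

Lemma uniq_flatten_map (I T : eqType) (f : I -> seq T) (s : seq I) :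
  uniq s -> {in s, forall i, uniq (f i)} ->
  {in s &, forall i j x, x \in f i -> x \in f j -> i = j} ->
  uniq (flatten [seq f i | i <- s]).
Proof.
elim: s => //= i s IH /andP[is_ us] uf df.
rewrite cat_uniq uf ?mem_head //=; apply/andP; split; last first.
  apply: IH => // [j js|j k js ks]; first by apply: uf; rewrite inE js orbT.
  by apply: df; rewrite inE ?js ?ks orbT.
apply/hasPn => x /flatten_mapP[j js xj]; apply: contra is_ => xi.
by rewrite (df i j _ _ x) // ?mem_head // inE js orbT.
Qed.

Lemma fcycle_eq_in (T : eqType) (f g : T -> T) (p : seq T) :
  {in p, f =1 g} -> fcycle f p -> fcycle g p.
Proof.
move=> fg; rewrite (@eq_in_cycle _ [in p] (frel f) (frel g)) //.
by move=> x y xp _ /=; rewrite fg.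
Qed.

Lemma fcycle_next (T : eqType) (f : T -> T) (p : seq T) (x : T) :
  fcycle f p -> x \in p -> next p x = f x.
Proof. by move=> cp xp; apply: nextE. Qed.

Lemma conj_fcycle (T : finType) (v c : {perm T}) p :
  fcycle v p -> fcycle (v ^ c)%g (map c p).
Proof.
rewrite cycle_map; apply: sub_cycle => x y /= /eqP <-.
by rewrite permJ.
Qed.

Lemma orbit_eq_cycle (T : finType) (v : {perm T}) (x : T) p :
  uniq (x :: p) -> fcycle v (x :: p) -> fingraph.orbit v x = x :: p.
Proof. by move=> u c; rewrite (fingraph.orbitE c u) ?mem_head //= eqxx rot0. Qed.

Lemma orbit_consP (T : finType) (f : T -> T) x : exists q, fingraph.orbit f x = x :: q.
Proof. by rewrite /fingraph.orbit -orderSpred /=; eexists. Qed.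

Lemma orbit_sym (T : finType) (v : {perm T}) (x y : T) :
  (x \in fingraph.orbit v y) = (y \in fingraph.orbit v x).
Proof. by rewrite -!fconnect_orbit fconnect_sym //; apply: perm_inj. Qed.

Lemma mem_porbit_fconnect (T : finType) (v : {perm T}) x y :
  (y \in porbit v x) = fconnect v x y.
Proof.
apply/porbitP/idP => [[i ->]|/iter_findex <-]; first by rewrite permX fconnect_iter.
by exists (findex v x y); rewrite permX.
Qed.

Section Words.
Variable T : finType.
Implicit Types (v t : {perm T}) (p q : seq T) (x y a b : T) (L : seq (seq T)).

Lemma cycle_permE q x : uniq q -> cycle_perm q x = next q x.
Proof. by move=> uq; rewrite permE undup_id. Qed.

Lemma cycle_perm_out q x : uniq q -> x \notin q -> cycle_perm q x = x.
Proof. by move=> uq xq; rewrite cycle_permE // next_nth (negPf xq). Qed.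

Lemma perm_of_cycles_out L x :
  uniq (flatten L) -> x \notin flatten L -> perm_of_cycles L x = x.
Proof.
elim: L => [|q L IH] /=; first by rewrite /perm_of_cycles big_nil perm1.
rewrite cat_uniq mem_cat => /and3P[uq _ uL]; rewrite negb_or => /andP[xq xL].
by rewrite /perm_of_cycles big_cons permM cycle_perm_out //; apply: IH.
Qed.

Lemma perm_of_cycles_in L q x :
  uniq (flatten L) -> q \in L -> x \in q -> perm_of_cycles L x = next q x.
Proof.
elim: L => [|q' L IH] //=.
rewrite cat_uniq inE => /and3P[uq' dis uL]; rewrite /perm_of_cycles big_cons permM.
have xin y : y \in flatten L -> y \notin q'.
  by move=> yL; apply: contra dis => yq'; apply/hasP; exists y.
case/orP=> [/eqP->|qL] xq.
  rewrite cycle_permE //; apply: perm_of_cycles_out => //.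
  by apply: contraL xq => /xin; rewrite mem_next.
rewrite cycle_perm_out //; first exact: IH.
by apply: xin; apply/flattenP; exists q.
Qed.

Lemma mul_tperm_out v a b x :
  v x != a -> v x != b -> (v * tperm a b)%g x = v x.
Proof. by move=> xa xb; rewrite permM tpermD // eq_sym. Qed.

Lemma fpath_mul_tperm v a b x p :
  a \notin p -> b \notin p -> fpath v x p -> fpath (v * tperm a b)%g x p.
Proof.
elim: p x => //= y p IH x; rewrite !inE !negb_or.
case/andP=> ay ap /andP[by_ bp] /andP[/eqP vx py].
by rewrite mul_tperm_out vx ?eqxx ?IH //= eq_sym.
Qed.

(** Multiplying by a transposition of letters from two different cycles
merges these cycles.  The default [y] of [head] makes the transposition trivial
when [p] is empty, so that the empty word needs no separate statement. *)
Lemma fcycle_join v p y q : uniq ((y :: q) ++ p) ->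
  fcycle v p -> fcycle v (y :: q) ->
  fcycle (v * tperm (head y p) y)%g (y :: q ++ p).
Proof.
case: p => [|a p]; first by rewrite /= cats0 tperm1 mulg1.
rewrite cat_uniq => /and3P[/andP[yq uq] /hasPn dis /andP[ap up]].
have /norP[ay aq] : ~~ ((a == y) || (a \in q)) by rewrite -in_cons dis ?mem_head.
have yp : y \notin p.
  by apply: contraT => /negPn yp; have := dis y; rewrite !inE yp eqxx orbT => /(_ isT).
rewrite /= !rcons_path => /andP[pp /eqP va] /andP[pq /eqP vy].
rewrite cat_path last_cat /= !fpath_mul_tperm //= !permM vy va.
by rewrite tpermR tpermL !eqxx.
Qed.

(** The converse of [fcycle_join]: a transposition of two letters of one
cycle cuts this cycle in two. *)
Lemma fcycle_split v p q y : uniq (p ++ y :: q) -> fcycle v (p ++ y :: q) ->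
  fcycle (v * tperm (head y p) y)%g p /\ fcycle (v * tperm (head y p) y)%g (y :: q).
Proof.
case: p => [|a p] /=; first by rewrite tperm1 mulg1.
rewrite mem_cat cat_uniq inE !negb_or -!andbA.
case/and4P=> ap ay aq /and4P[up /= yp _ /andP[yq uq]].
rewrite rcons_path cat_path last_cat /= => /andP[/andP[pp /andP[/eqP vp pq]] /eqP vq].
by rewrite !rcons_path !fpath_mul_tperm //= !permM vp vq tpermR tpermL !eqxx.
Qed.

End Words.

(** * Deleting the first letter, and moving it to another place *)

Section Deletion.
Variables (n : nat) (s : 'S_n.+2).
Implicit Types (j k : 'I_n.+1) (x : 'I_n.+2).

(** Since [s * tperm ord0 (s ord0)] fixes [ord0], it restricts to a
permutation of the other letters, which are renumbered by removing [lift ord0].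
This is [s] with [ord0] struck out of its cycle. *)
Definition del_fun k : 'I_n.+1 :=
  odflt k (unlift ord0 ((s * tperm ord0 (s ord0))%g (lift ord0 k))).

Lemma lift_del_fun k :
  lift ord0 (del_fun k) = (s * tperm ord0 (s ord0))%g (lift ord0 k).
Proof.
rewrite /del_fun; set v := (s * _)%g.
have v0 : v ord0 = ord0 by rewrite permM tpermR.
case: unliftP => [i -> //|] /=; rewrite -{2}v0 => /perm_inj/eqP.
by rewrite eq_sym (negPf (neq_lift _ _)).
Qed.

Lemma del_fun_inj : injective del_fun.
Proof.
move=> i k /(congr1 (lift ord0)); rewrite !lift_del_fun.
by move/perm_inj/lift_inj.
Qed.

Definition del : 'S_n.+1 := perm del_fun_inj.

Lemma lift_del k : lift ord0 (del k) = (s * tperm ord0 (s ord0))%g (lift ord0 k).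
Proof. by rewrite permE lift_del_fun. Qed.

Definition tail : seq 'I_n.+1 := pmap (unlift ord0) (fingraph.orbit s ord0).

Lemma orbit_tail : fingraph.orbit s ord0 = ord0 :: map (lift ord0) tail.
Proof.
rewrite /tail; have := orbit_uniq s ord0; rewrite /fingraph.orbit -orderSpred /=.
rewrite unlift_none /= => /andP[/negP s0 _]; congr (_ :: _).
elim: (traject _ _ _) s0 => //= x q IH; rewrite inE => /negP/norP[x0 /negP q0].
by case: (unliftP ord0 x) x0 => [k ->|->]; rewrite ?eqxx //= -IH.
Qed.

Lemma uniq_tail : uniq tail.
Proof.
have := orbit_uniq s ord0; rewrite orbit_tail /= => /andP[_].
by rewrite map_inj_uniq //; apply: lift_inj.
Qed.

Lemma fcycle_tail_lift : fcycle s (ord0 :: map (lift ord0) tail).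
Proof. by rewrite -orbit_tail; apply/cycle_orbit/perm_inj. Qed.

(** Multiplying by [tperm ord0 (s ord0)] splits the cycle of [ord0] into
[ord0] alone and the rest. *)
Lemma fcycle_tail : fcycle del tail.
Proof.
have := fcycle_tail_lift; have := orbit_uniq s ord0; rewrite orbit_tail.
case: tail => // a p u c; have s0 : s ord0 = lift ord0 a by move: c => /andP[/eqP].
have [_] := @fcycle_split _ s [:: ord0] (map (lift ord0) p) (lift ord0 a) u c.
rewrite -map_cons cycle_map -s0; apply: sub_cycle => i k /=.
by rewrite -lift_del (inj_eq (@lift_inj _ _)).
Qed.

Lemma del_out k : k \notin tail -> s (lift ord0 k) = lift ord0 (del k).
Proof.
move=> kP; rewrite lift_del mul_tperm_out //.
- apply: contra kP => /eqP s0; have : lift ord0 k \in fingraph.orbit s ord0.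
    rewrite -fconnect_orbit fconnect_sym; last exact: perm_inj.
    by have := fconnect1 s (lift ord0 k); rewrite s0.
  by rewrite orbit_tail inE eq_sym (negPf (neq_lift _ _)) mem_map //; apply: lift_inj.
- by rewrite (inj_eq perm_inj) eq_sym neq_lift.
Qed.

Lemma mem_tail_del k : (del k \in tail) = (k \in tail).
Proof.
apply/idP/idP => [|]; last exact: mem_fcycle fcycle_tail _.
have cy := fcycle_tail; have ut := uniq_tail => dk.
rewrite -[k](@perm_inj _ del (prev tail (del k))) ?mem_prev //.
by rewrite (eqP (prev_cycle cy dk)).
Qed.

(** [s] with its letter [ord0] carried to place [x], the other letters
keeping their relative order: conjugation by the cycle
[0 -> x, 1 -> 0, .., x -> x - 1]. *)
Definition move_first (x : 'I_n.+2) : 'S_n.+2 := (s ^ lift_perm ord0 x 1)%g.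

Lemma move_first0 : move_first ord0 = s.
Proof. by rewrite /move_first lift_perm1 conjg1. Qed.

Lemma move_first_lift x k :
  k \notin tail -> move_first x (lift x k) = lift x (del k).
Proof.
move=> kP; have -> : lift x k = lift_perm ord0 x 1%g (lift ord0 k).
  by rewrite lift_perm_lift perm1.
by rewrite permJ del_out // lift_perm_lift perm1.
Qed.

Lemma move_first_orbit x :
  fingraph.orbit (move_first x) x = x :: map (lift x) tail.
Proof.
apply: orbit_eq_cycle.
  rewrite /= map_inj_uniq ?uniq_tail ?andbT; last exact: lift_inj.
  by apply/mapP => -[k _ /eqP]; rewrite (negPf (neq_lift _ _)).
have := conj_fcycle (lift_perm ord0 x 1%g) fcycle_tail_lift.
rewrite map_cons lift_perm_id -map_comp.
rewrite (eq_map (g := lift x)) // => k /=.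
by rewrite lift_perm_lift perm1.
Qed.

Lemma notin_tail_orbit j k : j \notin tail -> k \in fingraph.orbit del j -> k \notin tail.
Proof.
move=> jP; rewrite -fconnect_orbit => jk.
have cl : fclosed del (mem tail).
  by apply: (@intro_closed _ (frel del)) => [|x y /= /eqP <-];
    [apply: fconnect_sym; apply: perm_inj | rewrite mem_tail_del].
by rewrite -(closed_connect cl jk).
Qed.

Lemma move_first_orbit_out x k : k \notin tail ->
  fingraph.orbit (move_first x) (lift x k) = map (lift x) (fingraph.orbit del k).
Proof.
move=> kP; have [q oq] := orbit_consP del k.
have cy : fcycle del (k :: q) by rewrite -oq; apply/cycle_orbit/perm_inj.
have uq : uniq (k :: q) by rewrite -oq orbit_uniq.
rewrite oq map_cons; apply: orbit_eq_cycle; rewrite -map_cons.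
  by rewrite map_inj_uniq //; apply: lift_inj.
rewrite cycle_map; apply: (@sub_in_cycle _ [predC tail] _ _ _ _ _ cy).
  by move=> i l iP _ /eqP <- /=; rewrite move_first_lift.
by apply/allP => i; rewrite -oq; apply: notin_tail_orbit.
Qed.

Lemma move_first_pos1 j : lift (pos0 j) j = pos1 j.
Proof. by apply: val_inj; rewrite /= /bump leqnn. Qed.

(** With the first letter at [pos0 j], merging it with its right neighbour
amounts to forgetting it: every place [j] thus produces permutations of the same
letters, numbered in the same way as for [del]. *)
Lemma merge_lift j k : merge_letter j (lift (pos0 j) k) = k.
Proof.
rewrite /merge_letter; case: (unliftP (pos1 j) (lift (pos0 j) k)) => [i|] /(congr1 val) /=;
  rewrite /bump => e; apply: val_inj; move: e => /=; lia.
Qed.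

Lemma merge_lift_map j p : map (merge_letter j) (map (lift (pos0 j)) p) = p.
Proof. by rewrite -map_comp -[RHS]map_id; apply: eq_map => k; apply: merge_lift. Qed.

(** The letters of the two cycles (or of the single one) on which the
recurrence acts when the first letter exchanges places with [j]. *)
Definition region j : {pred 'I_n.+1} := [pred k | (k \in tail) || (k \in fingraph.orbit del j)].

Lemma not_pos0 j x : x != pos0 j -> exists k, x = lift (pos0 j) k.
Proof. by case: (unliftP (pos0 j) x) => [k ->|->]; [exists k | rewrite eqxx]. Qed.

Lemma region_pos j k :
  (k \in region j) = (lift (pos0 j) k \in cycle_word (move_first (pos0 j)) (pos0 j))
    || (lift (pos0 j) k \in cycle_word (move_first (pos0 j)) (pos1 j)).
Proof.
rewrite /cycle_word move_first_orbit in_cons eq_sym (negPf (neq_lift _ _)) /=.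
rewrite mem_map; last exact: lift_inj.
rewrite inE; have [//|kP] := boolP (k \in tail).
rewrite /= -move_first_pos1 [RHS]orbit_sym move_first_orbit_out // mem_map.
  exact: orbit_sym.
exact: lift_inj.
Qed.

Lemma other_cyclesP j c : c \in other_cycles j (move_first (pos0 j)) ->
  exists2 k, k \notin region j & c = map (lift (pos0 j)) (fingraph.orbit del k).
Proof.
case/mapP => x; rewrite mem_filter => /andP[/and3P[_ x0 x1] _] ->.
have [k xk] : exists k, x = lift (pos0 j) k.
  by apply: not_pos0; apply: contra x0 => /eqP ->; apply: in_orbit.
rewrite xk in x0 x1 *; exists k; first by rewrite region_pos negb_or x0.
rewrite /cycle_word move_first_orbit_out //.
have : k \notin region j by rewrite region_pos negb_or x0.
by rewrite inE negb_or => /andP[].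
Qed.

Lemma notin_region_orbit j k l :
  k \notin region j -> l \in fingraph.orbit del k -> l \notin region j.
Proof.
rewrite !inE !negb_or => /andP[kP kj] lk; rewrite (notin_tail_orbit kP) //=.
rewrite -fconnect_orbit in lk; rewrite -!fconnect_orbit in kj *.
apply: contra kj => jl; apply: connect_trans jl _.
by rewrite fconnect_sym //; apply: perm_inj.
Qed.

(** The words of [d] rearrange the letters of [region j], and the remaining
cycle words, one for each root outside [region j], are exactly the cycles of [del]
there: they are pairwise disjoint and cover everything outside [region j]. *)
Lemma merged_perm_spec j d : uniq (flatten d) -> flatten d =i region j ->
  (forall c k, c \in d -> k \in c ->
     merged_perm j (move_first (pos0 j)) d k = next c k) /\
  (forall k, k \notin region j -> merged_perm j (move_first (pos0 j)) d k = del k).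
Proof.
move=> ud ed; set t := move_first _.
set L := d ++ [seq map (merge_letter j) q | q <- other_cycles j t].
have inL q : q \in [seq map (merge_letter j) q | q <- other_cycles j t] ->
    exists2 k, k \notin region j & q = fingraph.orbit del k.
  by case/mapP => c /other_cyclesP[k kR ->] ->; exists k; rewrite ?merge_lift_map.
have uL : uniq (flatten L).
  rewrite flatten_cat cat_uniq ud /=; apply/andP; split.
    apply/hasPn => x /flattenP[q /inL[k kR ->] xk]; rewrite ed.
    exact: notin_region_orbit xk.
  rewrite -map_comp; apply: uniq_flatten_map.
  - by rewrite filter_uniq ?enum_uniq.
  - move=> x xI; have /inL[k _] : map (merge_letter j) (cycle_word t x)
      \in [seq map (merge_letter j) q | q <- other_cycles j t].
      by apply: map_f; apply: (map_f (cycle_word t)).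
    by move=> /= ->; rewrite orbit_uniq.
  - move=> x y xI yI z.
    have mI c : c \in other_cycles j t -> z \in map (merge_letter j) c ->
        lift (pos0 j) z \in c.
      case/other_cyclesP=> k _ ->; rewrite merge_lift_map mem_map //.
      exact: lift_inj.
    move=> /= /(mI _ (map_f _ xI)) zx /(mI _ (map_f _ yI)) zy.
    move: xI yI zx zy; rewrite !mem_filter => /andP[/andP[/eqP rx _] _].
    move=> /andP[/andP[/eqP ry _] _]; rewrite -!fconnect_orbit => zx zy.
    have cs : connect_sym (frel t) by apply: fconnect_sym; apply: perm_inj.
    rewrite -rx -ry.
    by apply/(fingraph.rootP cs); apply: connect_trans zx _; rewrite cs.
split=> [c x cd xc|x xR]; first by apply: perm_of_cycles_in => //; rewrite mem_cat cd.
set y := froot t (lift (pos0 j) x).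
have xy : lift (pos0 j) x \in cycle_word t y.
  rewrite -fconnect_orbit fconnect_sym ?connect_root //; exact: perm_inj.
have yI : cycle_word t y \in other_cycles j t.
  apply: map_f; rewrite mem_filter mem_enum andbT.
  have := xR; rewrite region_pos negb_or => /andP[x0 x1].
  rewrite roots_root /=; last by apply: fconnect_sym; apply: perm_inj.
  have cs : connect_sym (frel t) by apply: fconnect_sym; apply: perm_inj.
  rewrite -fconnect_orbit in xy; rewrite -!fconnect_orbit in x0 x1 *.
  by apply/andP; split; [apply: contra x0 | apply: contra x1] => h;
    apply: connect_trans h xy.
have yL : map (merge_letter j) (cycle_word t y)
   \in [seq map (merge_letter j) q | q <- other_cycles j t] by apply: map_f.
have xq : x \in map (merge_letter j) (cycle_word t y).
  by rewrite -(merge_lift j x) map_f.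
rewrite (@perm_of_cycles_in _ L (map (merge_letter j) (cycle_word t y))) ?mem_cat ?yL ?orbT //.
have [k kR E] := inL _ yL; rewrite E in xq *.
by apply: fcycle_next xq; apply/cycle_orbit/perm_inj.
Qed.

End Deletion.

Local Open Scope ring_scope.

(** * Moving the first letter to the end *)

Lemma swap_move_first n (s : 'S_n.+2) (j : 'I_n.+1) :
  swap_conj j (move_first s (pos0 j)) = move_first s (pos1 j).
Proof.
rewrite /swap_conj /move_first -conjgM; congr (_ ^ _)%g.
apply/permP => x; rewrite permM; case: (unliftP ord0 x) => [k ->|->].
  rewrite !lift_perm_lift !perm1; apply: val_inj.
  case: tpermP => [/(congr1 val)|/(congr1 val)|/eqP k0 /eqP k1];
    rewrite /= /bump; [lia | lia | move: k0 k1; rewrite -!val_eqE /= /bump; lia].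
by rewrite !lift_perm_id tpermL.
Qed.

Lemma move_first_last n (s : 'S_n.+2) :
  move_first s ord_max = (s ^ (std_cycle n.+2)^-1)%g.
Proof.
congr (_ ^ _)%g; rewrite -[LHS](mulgK (std_cycle n.+2)) -[RHS]mul1g.
congr (_ * _)%g.
apply/permP => x; rewrite permM perm1 [std_cycle _ _]permE.
case: (unliftP ord0 x) => [k ->|->].
  rewrite lift_perm_lift perm1; apply: val_inj => /=.
  by rewrite /bump leqNgt (ltn_ord k) /= add0n modn_small ?add1n // ltnS ltn_ord.
by rewrite lift_perm_id; apply: val_inj; rewrite /= modnn.
Qed.

(** The corrections met when the first letter passes all the others add up
to the sum over [j] of [F j - F (del s j)], which vanishes because [del s] permutes
the letters. *)
Lemma cyclic_invariance (A : comNzRingType) (w : forall m, 'S_m -> A) :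
  (forall n (s : 'S_n.+2), exists F : 'I_n.+1 -> A, forall j,
     w _ (move_first s (pos0 j)) =
       w _ (move_first s (pos1 j)) + (F j - F (del s j))) ->
  forall m (s : 'S_m), (1 <= m)%N -> w m (s ^ std_cycle m)%g = w m s.
Proof.
move=> step [|[|n]] s // _.
  by congr (w _ _); apply/permP => x; rewrite [LHS]ord1 [RHS]ord1.
rewrite -[in RHS](conjgK (std_cycle n.+2) s) -move_first_last.
move: (s ^ _)%g => {}s; have [F sF] := step n s.
pose f i := w n.+2 (move_first s (inord i)).
suff : f n.+1 - f 0%N = 0.
  move/eqP; rewrite subr_eq0 /f => /eqP; rewrite -[inord 0]/(inord (@ord0 n.+1)) inord_val.
  rewrite move_first0 => <-; congr (w _ (move_first _ _)).
  by apply: val_inj; rewrite /= inordK.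
rewrite -(telescope_sumr _ (leq0n _)) big_mkord.
rewrite (eq_bigr (fun j => F (del s j) - F j)) => [|j _].
  by rewrite sumrB [X in _ - X](reindex_inj (@perm_inj _ (del s))) subrr.
have p0 : inord j = pos0 j by apply: val_inj; rewrite /= inordK // (ltn_trans (ltn_ord j)).
have p1 : inord j.+1 = pos1 j.
  by apply: val_inj; rewrite /= inordK // !ltnS -ltnS.
by rewrite /f p0 p1 sF opprD addrA subrr add0r opprB.
Qed.

(** * The corrections as differences of a potential *)

Section Corrections.
Variables (n : nat) (s : 'S_n.+2) (j : 'I_n.+1).
Implicit Types (t v : 'S_n.+1) (c p q : seq 'I_n.+1).
Let u := del s.
Let P := tail s.

Lemma region_del k : (del s k \in region s j) = (k \in region s j).
Proof.
rewrite !inE mem_tail_del; congr (_ || _).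
by rewrite -!fconnect_orbit -same_fconnect1_r //; apply: perm_inj.
Qed.

Lemma regionE k : (k \in region s j) = (k \in P) || (k \in fingraph.orbit u j).
Proof. by []. Qed.

Lemma region_orbit k : k \in fingraph.orbit (del s) j -> k \in region s j.
Proof. by move=> kj; rewrite inE kj orbT. Qed.

Lemma region_tail : j \in P -> region s j =i P.
Proof.
move=> jP k; rewrite inE; apply/orP/idP => [[] //|]; last by left.
rewrite (fingraph.orbitE (fcycle_tail s) (uniq_tail s) jP).
by rewrite mem_rot.
Qed.

Lemma merged_perm_eq d t :
    uniq (flatten d) -> flatten d =i region s j ->
    {in d, forall c, fcycle t c} -> {in [predC region s j], t =1 u} ->
  merged_perm j (move_first s (pos0 j)) d = t.
Proof.
move=> ud ed td tu; have [din dout] := merged_perm_spec ud ed.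
apply/permP => k; have [kR|kR] := boolP (k \in region s j).
  move: kR; rewrite -ed => /flattenP[c cd kc].
  by rewrite (din c) // (fcycle_next (td c cd)).
by rewrite dout // tu.
Qed.

(** [t] is the permutation which has [c] as a cycle and agrees with [del s]
elsewhere, that is, the one described by a bracket with the single word [c].  Since
[c] matters only up to rotation, proofs are free to choose where it starts. *)
Definition joins c t :=
  [/\ uniq c, c =i region s j, fcycle t c & {in [predC region s j], t =1 u}].

Lemma joins_catC c1 c2 t : joins (c1 ++ c2) t -> joins (c2 ++ c1) t.
Proof.
case=> uc cR ct tu; split; rewrite 1?uniq_catC 1?cycle_catC // => k.
by rewrite -cR !mem_cat orbC.
Qed.

Lemma merged_perm_joins c t : joins c t -> merged_perm j (move_first s (pos0 j)) [:: c] = t.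
Proof.
case=> uc cR ct tu; apply: merged_perm_eq; rewrite ?flatten_seq1 //= ?cats0 //.
by move=> q; rewrite inE => /eqP ->.
Qed.

Lemma merged_fcycle c : uniq c -> c =i region s j ->
  fcycle (merged_perm j (move_first s (pos0 j)) [:: c]) c.
Proof.
move=> uc cR; have [||din _] := @merged_perm_spec _ s j [:: c]; rewrite /= ?cats0 //.
by apply: fcycle_eq_in (cycle_next uc) => k kc; rewrite (din c) ?mem_head.
Qed.

Lemma porbit_merged c : uniq c -> c =i region s j ->
  porbit (merged_perm j (move_first s (pos0 j)) [:: c]) j =i c.
Proof.
move=> uc cR k; rewrite mem_porbit_fconnect (fconnect_cycle (merged_fcycle uc cR)) //.
by rewrite cR region_orbit // in_orbit.
Qed.

Lemma merged_perm_inversion c t : joins (rev c) t ->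
  is_cycle_inversion (merged_perm j (move_first s (pos0 j)) [:: c]) t j.
Proof.
case=> uc cR ct tu; rewrite rev_uniq in uc.
have cR' : c =i region s j by move=> k; rewrite -cR mem_rev.
have ct0 := merged_fcycle uc cR'; have mem_c := porbit_merged uc cR'.
have [||_ dout] := @merged_perm_spec _ s j [:: c]; rewrite /= ?cats0 //.
move=> k; rewrite mem_c; case: ifP => [kc|/negbT kc]; last first.
  have kR : k \notin region s j by rewrite -cR'.
  by rewrite dout // tu.
apply: (@perm_inj _ (merged_perm j (move_first s (pos0 j)) [:: c])); rewrite permKV.
rewrite -(fcycle_next ct) ?mem_rev // next_rev //.
by rewrite -(fcycle_next ct0) ?mem_prev // next_prev.
Qed.

Lemma mul_tperm_region v a b :
    {in [predC region s j], v =1 u} -> a \in region s j -> b \in region s j ->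
  {in [predC region s j], (v * tperm a b)%g =1 u}.
Proof.
move=> vu aR bR k kR; rewrite mul_tperm_out ?vu //.
  by apply: contra kR => /eqP ka; rewrite -region_del -/u ka.
by apply: contra kR => /eqP ka; rewrite -region_del -/u ka.
Qed.

Lemma region_head k p : p =i P -> k \in region s j -> head k p \in region s j.
Proof.
by case: p => //= a p pP _; rewrite inE -/P -pP mem_head.
Qed.

(** The word [j :: q ++ p] is the cycle of [j] with [p] inserted just before
[j].  The permutation [v] is [del s] when [p] is [tail s], and [del s] with the
tail reversed when [p] is [rev (tail s)]. *)
Lemma joins_before v p q : j \notin P -> fingraph.orbit u j = j :: q ->
    uniq p -> p =i P -> fcycle v p -> {in [predC P], v =1 u} ->
  joins (j :: q ++ p) (v * tperm (head j p) j)%g.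
Proof.
move=> jP oj up pP vp vu.
have qP k : k \in j :: q -> k \notin P.
  by rewrite -oj; apply: notin_tail_orbit.
have uq : uniq ((j :: q) ++ p).
  rewrite cat_uniq up -oj orbit_uniq andbT /=; apply/hasPn => k; rewrite pP oj.
  by apply: contraL => /qP.
have jR : j \in region s j by rewrite region_orbit ?in_orbit.
split=> // [k||].
- by rewrite -cat_cons mem_cat pP -oj orbC.
- apply: fcycle_join => //; have := cycle_orbit (@perm_inj _ u) j; rewrite oj.
  by apply: fcycle_eq_in => k kq; rewrite vu //; apply: qP.
- apply: mul_tperm_region => //; last exact: region_head.
  by move=> k; rewrite !inE negb_or => /andP[kP _]; rewrite vu.
Qed.

(** Inserting [p] just after [j] is inserting it just before the successor of
[j], so that this is [joins_before] for [u j] in place of [j]. *)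
Lemma joins_after v p q : j \notin P -> fingraph.orbit u j = j :: q ->
    uniq p -> p =i P -> fcycle v p -> {in [predC P], v =1 u} ->
  joins (j :: p ++ q) (v * tperm (head (u j) p) (u j))%g.
Proof.
move=> jP oj up pP vp vu.
have cyj : fcycle u (j :: q) by rewrite -oj; apply/cycle_orbit/perm_inj.
case: q oj cyj => [|y q] oj.
  rewrite /= andbT => /eqP uj; rewrite uj cats0.
  by have := joins_before jP oj up pP vp vu; rewrite cat0s.
move=> cyj; have uj : u j = y by case/andP: cyj => /eqP.
have uq : uniq (y :: rcons q j).
  by rewrite -rcons_cons -rot1_cons rot_uniq -oj orbit_uniq.
have qP k : k \in y :: rcons q j -> k \notin P.
  by rewrite -rcons_cons -rot1_cons mem_rot -oj; apply: notin_tail_orbit.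
have uqp : uniq ((y :: rcons q j) ++ p).
  rewrite cat_uniq uq up andbT /=; apply/hasPn => k; rewrite pP.
  by apply: contraL => /qP.
have yR : y \in region s j by rewrite region_orbit // oj !inE eqxx orbT.
rewrite uj -(cat1s j) catA; apply: (@joins_catC (y :: q)).
split=> // [|k||].
- by rewrite -cat_rcons in uqp *.
- rewrite regionE -pP oj !(mem_cat, inE).
  by case: (k == y); case: (k == j); case: (k \in p); case: (k \in q).
- rewrite -[_ ++ _]/(y :: q ++ [:: j] ++ p) -cat_rcons.
  apply: fcycle_join => //; rewrite -rcons_cons -rot1_cons rot_cycle.
  apply: fcycle_eq_in cyj => k kq; rewrite vu //; apply: qP.
  by rewrite -rcons_cons -rot1_cons mem_rot.
- apply: mul_tperm_region => //; last exact: region_head.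
  by move=> k; rewrite !inE negb_or => /andP[kP _]; rewrite vu.
Qed.

Lemma split_before p1 p2 : P = p1 ++ j :: p2 ->
  merged_perm j (move_first s (pos0 j)) [:: p1; j :: p2] =
  (u * tperm (head j P) j)%g.
Proof.
move=> eP; have jP : j \in P by rewrite eP mem_cat mem_head orbT.
have := fcycle_tail s; have := uniq_tail s; rewrite -/P -/u eP => up cp.
have [c1 c2] := fcycle_split up cp.
have -> : head j (p1 ++ j :: p2) = head j p1 by case: (p1).
apply: merged_perm_eq; rewrite /= ?cats0 //.
- by move=> k; rewrite region_tail // eP.
- by move=> c; rewrite !inE => /orP[] /eqP ->.
- apply: mul_tperm_region => //; rewrite region_tail //.
  by rewrite eP; case: (p1) => [|a p] /=; rewrite mem_head.
Qed.

Lemma del_split p1 p2 : P = p1 ++ j :: p2 -> u j = head j (p2 ++ p1).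
Proof.
move=> eP; have := fcycle_tail s; rewrite -/P eP cycle_catC.
by case: p2 {eP} => [|y p2] /=; [case: p1 => [|a p1] |] => /= /andP[/eqP].
Qed.

(** As for [joins_after]: cutting the tail after [j] is cutting it before the
successor of [j].  When [j] is the last letter of the tail, the successor is the
head, and both cuts leave the tail whole. *)
Lemma split_after p1 p2 : P = p1 ++ j :: p2 ->
  merged_perm j (move_first s (pos0 j)) [:: j :: p1; p2] =
  (u * tperm (head (u j) P) (u j))%g.
Proof.
move=> eP; have jP : j \in P by rewrite eP mem_cat mem_head orbT.
have := fcycle_tail s; have := uniq_tail s; rewrite -/P -/u => up cp.
have ujP : u j \in P by rewrite mem_tail_del.
have uj := del_split eP.
have [c1 c2] : fcycle (u * tperm (head (u j) P) (u j))%g (rcons p1 j) /\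
               fcycle (u * tperm (head (u j) P) (u j))%g p2.
  case: p2 eP uj => [|y p2] eP uj.
    suff -> : head (u j) P = u j by rewrite tperm1 mulg1 -cats1 -eP.
    by rewrite uj eP; case: (p1).
  have eP' : P = rcons p1 j ++ y :: p2 by rewrite cat_rcons.
  have -> : head (u j) P = head y (rcons p1 j) by rewrite eP'; case: (p1).
  by rewrite uj; apply: fcycle_split; rewrite -eP'.
apply: merged_perm_eq; rewrite /= ?cats0.
- by have : uniq ([:: j] ++ p1 ++ p2) by rewrite uniq_catCA /= -eP.
- by move=> k; rewrite region_tail // eP !(mem_cat, inE) orbCA.
- by move=> c; rewrite !inE => /orP[] /eqP -> //; rewrite -(rot_cycle 1) rot1_cons.
- apply: mul_tperm_region => //; rewrite region_tail //.
  by case: P ujP => [|a p] //= _; rewrite mem_head.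
Qed.

(** The cycle [P] of [u] is undone, and its letters are put on the cycle [c]
instead. *)
Definition reorder c : 'S_n.+1 := (cycle_perm c * (cycle_perm P)^-1 * u)%g.

Lemma fcycle_reorder c : uniq c -> c =i P -> fcycle (reorder c) c.
Proof.
move=> uc cP; apply: fcycle_eq_in (cycle_next uc) => k kc.
rewrite !permM cycle_permE //; set y := next c k.
have yP : y \in P by rewrite -cP mem_next.
set x := (cycle_perm P)^-1%g y; have yx : y = cycle_perm P x by rewrite permKV.
have xP : x \in P.
  apply: contraLR yP => xP; rewrite yx cycle_perm_out //; exact: uniq_tail.
by rewrite yx cycle_permE ?uniq_tail // (fcycle_next (fcycle_tail s)).
Qed.

Lemma reorder_out c : uniq c -> c =i P -> {in [predC P], reorder c =1 u}.
Proof.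
move=> uc cP k kP; rewrite !permM cycle_perm_out ?cP //; congr (u _).
by apply: (@perm_inj _ (cycle_perm P)); rewrite permKV cycle_perm_out ?uniq_tail.
Qed.

Lemma joins_reorder c : j \in P -> uniq c -> c =i P -> joins c (reorder c).
Proof.
move=> jP uc cP; split=> // [k||k].
- by rewrite region_tail.
- exact: fcycle_reorder.
- by rewrite inE region_tail // => kP; rewrite reorder_out.
Qed.

Variables (A : comNzRingType) (C0 : A) (w : forall m, 'S_m -> A).
Let W := bracket j C0 w (move_first s (pos0 j)).

Lemma bracket1 k c : W [:: k :: c] = w (merged_perm j (move_first s (pos0 j)) [:: k :: c]).
Proof. by rewrite /W /bracket /= expr0 mul1r. Qed.

(** Both kinds of correction in the gl rule have this form: the tail is
inserted before [k] if [k] lies outside it, and is cut before [k] if [k] lies in it.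
The factor [C0] accounts for the empty piece of a cut before the head. *)
Definition gl_potential k : A :=
  C0 ^+ (ohead P == Some k) * w (u * tperm (head k P) k)%g.

Lemma split_bracket p1 p2 : P = p1 ++ j :: p2 ->
  W [:: p1; j :: p2] - W [:: j :: p1; p2] = gl_potential j - gl_potential (u j).
Proof.
move=> eP; rewrite /W /bracket split_before // split_after // /gl_potential /=.
have up : uniq (p1 ++ j :: p2) by rewrite -eP; apply: uniq_tail.
have uj := del_split eP; congr (C0 ^+ _ * _ - C0 ^+ _ * _); rewrite !addn0 ?add0n.
  congr nat_of_bool; rewrite eP; case: p1 up {eP uj} => [|a p1] /=; first by rewrite !eqxx.
  rewrite mem_cat !inE !negb_or => /andP[/and3P[_ aj _] _].
  by apply/esym/negbTE; apply: contra aj => /eqP[->].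
congr nat_of_bool; rewrite uj eP; case: p2 up {eP uj} => [|y p2] /=.
  by case: p1 => [|a p1] /=; rewrite !eqxx.
case: p1 => [|a p1] /=.
  rewrite !inE !negb_or => /andP[/andP[jy _] _].
  by apply/esym/negbTE; apply: contra jy => /eqP[->].
rewrite mem_cat !inE !negb_or => /andP[/and4P[_ _ ay _] _].
by apply/esym/negbTE; apply: contra ay => /eqP[->].
Qed.

Lemma ohead_notin k : k \notin P -> (ohead P == Some k) = false.
Proof.
case: P => //= a p; rewrite inE negb_or => /andP[ka _].
by apply/negbTE; apply: contra ka => /eqP[->].
Qed.

Lemma join_bracket q : j \notin P -> fingraph.orbit u j = j :: q ->
  W [:: j :: q ++ P] - W [:: j :: P ++ q] = gl_potential j - gl_potential (u j).
Proof.
move=> jP oj; have ujP : u j \notin P by rewrite mem_tail_del.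
rewrite !bracket1 /gl_potential !ohead_notin // !expr0 !mul1r.
have cp := fcycle_tail s; have up := uniq_tail s.
rewrite (merged_perm_joins (joins_before jP oj up _ cp _)) //.
by rewrite (merged_perm_joins (joins_after jP oj up _ cp _)).
Qed.

Hypothesis winv : forall m (t t' : 'S_m) (a : 'I_m), is_cycle_inversion t t' a ->
  w t' = (-1) ^+ #|porbit t a| * w t.

(** Inverting the word of a bracket costs a sign.  This brings the words with
a reversed [Q], whose shape changes with [j], back to words in which only the
tail is reversed. *)
Lemma joins_rev c t : joins (rev c) t ->
  w (merged_perm j (move_first s (pos0 j)) [:: c]) = (-1) ^+ size c * w t.
Proof.
move=> jt; have [uc cR _ _] := jt; rewrite rev_uniq in uc.
have cR' : c =i region s j by move=> k; rewrite -cR mem_rev.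
rewrite (winv (merged_perm_inversion jt)) (eq_card (porbit_merged uc cR')).
by rewrite (card_uniqP uc) mulrA -expr2 sqrr_sign mul1r.
Qed.

(** For [k] outside the tail this is the insertion of the reversed tail before
[k]; for [k] in the tail, the part of the tail from [k] on is reversed.  The signs of
the second kind alternate along the tail: this turns the sum of two brackets in the
recurrence into a difference. *)
Definition so_potential k : A :=
  if k \in P then
    (-1) ^+ (size P + index k P).+1 *
      w (reorder (take (index k P) P ++ rev (drop (index k P) P)))
  else (-1) ^+ (size P).+1 * w (reorder (rev P) * tperm (head k (rev P)) k)%g.

(** Inverting the words replaces the factor [(-1) ^+ size q] by a sign depending on
the size of the tail only, and leaves the words with the reversed tail inserted
before, resp. after, [j]. *)
Lemma join_extra q : j \notin P -> fingraph.orbit u j = j :: q ->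
  (-1) ^+ size q * (W [:: j :: P ++ rev q] - W [:: j :: rev q ++ P])
  = so_potential j - so_potential (u j).
Proof.
move=> jP oj; have ujP : u j \notin P by rewrite mem_tail_del.
rewrite !bracket1 /so_potential (negPf jP) (negPf ujP) -mulrBr.
have urp : uniq (rev P) by rewrite rev_uniq; apply: uniq_tail.
have rpP : rev P =i P by move=> k; rewrite mem_rev.
have cp := fcycle_reorder urp rpP; have out := reorder_out urp rpP.
rewrite (@joins_rev (j :: P ++ rev q)
  (reorder (rev P) * tperm (head j (rev P)) j)%g); last first.
  rewrite rev_cons rev_cat revK -cats1; apply: (@joins_catC [:: j]).
  exact: joins_before.
rewrite (@joins_rev (j :: rev q ++ P)
  (reorder (rev P) * tperm (head (u j) (rev P)) (u j))%g); last first.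
  rewrite rev_cons rev_cat revK -cats1; apply: (@joins_catC [:: j]).
  exact: joins_after.
rewrite /= !size_cat size_rev [in X in _ - X]addnC -mulrBr mulrA; congr (_ * _).
by rewrite -exprD -[RHS]signr_odd -signr_odd; congr (_ ^+ nat_of_bool _); lia.
Qed.

(** The two brackets have the cycles obtained by reversing the tail from [j]
on, resp. from the letter after [j] on.  When [j] is the last letter, the second one
is the whole tail, whereas [so_potential (u j)] reverses all of it: the two values
agree by the inversion rule. *)
Lemma split_extra p1 p2 : P = p1 ++ j :: p2 ->
  (-1) ^+ size p2 * (W [:: j :: p1 ++ rev p2] + W [:: j :: rev p2 ++ p1])
  = so_potential j - so_potential (u j).
Proof.
move=> eP; have jP : j \in P by rewrite eP mem_cat mem_head orbT.
have ujP : u j \in P by rewrite mem_tail_del.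
have uP : uniq P := uniq_tail s.
rewrite !bracket1 /so_potential jP ujP mulrDr.
have rjoins c : perm_eq c P -> joins c (reorder c).
  by move=> cP; apply: joins_reorder; rewrite ?(perm_uniq cP) //; apply: perm_mem.
have jp1 : j \notin p1.
  by move: uP; rewrite eP cat_uniq /= negb_or => /and3P[_ /andP[]].
have ij : index j P = size p1 by rewrite eP index_cat (negPf jp1) /= eqxx addn0.
congr (_ + _).
  rewrite ij {2 3}eP take_size_cat // drop_size_cat // rev_cons -cats1 catA.
  rewrite (@merged_perm_joins _ (reorder ((p1 ++ rev p2) ++ [:: j]))); last first.
    apply: (@joins_catC _ [:: j]); apply: rjoins.
    by rewrite eP -catA perm_cat2l perm_catC perm_cons perm_rev.
  congr (_ * _); rewrite -[LHS]signr_odd -[RHS]signr_odd eP size_cat /=.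
  by congr (_ ^+ nat_of_bool _); lia.
case: p2 eP ij => [|y p2] eP ij.
  have uj := del_split eP; rewrite cat0s in uj.
  have -> : index (u j) P = 0%N.
    by rewrite uj eP; case: (p1) => [|a p] /=; rewrite eqxx.
  (* Here the potential at the head of the tail carries the opposite sign, which
     the reversal of the whole tail compensates. *)
  rewrite take0 drop0 !cat0s addn0 expr0 mul1r exprS mulN1r mulNr opprK.
  rewrite -(@joins_rev P); last by apply: rjoins; rewrite perm_rev.
  congr (w _).
  have := rjoins P (perm_refl _); rewrite {1}eP => /joins_catC /merged_perm_joins /= ->.
  by rewrite -(merged_perm_joins (rjoins P _)).
have uj : u j = y by rewrite (del_split eP).
have eP' : P = rcons p1 j ++ y :: p2 by rewrite cat_rcons.
have iy : index (u j) P = (size p1).+1.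
  move: uP; rewrite eP' cat_uniq => /and3P[_ /= /norP[yp _] _].
  by rewrite index_cat uj (negPf yp) /= eqxx addn0 size_rcons.
rewrite iy {2 3}eP'.
rewrite take_size_cat ?size_rcons // drop_size_cat ?size_rcons //.
have jj : joins ((j :: rev (y :: p2)) ++ p1) (reorder (rcons p1 j ++ rev (y :: p2))).
  apply: joins_catC; rewrite -cat_rcons; apply: rjoins.
  by rewrite eP' perm_cat2l perm_rev.
rewrite (merged_perm_joins jj) -mulNr; congr (_ * _).
rewrite -[X in _ = - X]signr_odd -[LHS]signr_odd eP size_cat /= -signrN.
by congr (_ ^+ nat_of_bool _); lia.
Qed.

Hypothesis no2tors : forall x : A, x + x = 0 -> x = 0.

(** Inverting a cycle of length one changes nothing but the sign of the
value. *)
Lemma fixpoint_value_eq0 m (t : 'S_m) a : t a = a -> w t = 0.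
Proof.
move=> ta; have pa x : (x \in porbit t a) = (x == a).
  rewrite mem_porbit_fconnect (@fconnect_cycle _ t [:: a]) ?inE //=; last by rewrite ta eqxx.
have /winv : is_cycle_inversion t t a.
  move=> x; rewrite pa; case: eqP => // ->.
  by apply: (@perm_inj _ t); rewrite permKV !ta.
rewrite (eq_card (B := pred1 a)) // card1 mulN1r => /eqP.
by rewrite -addr_eq0 => /eqP /no2tors.
Qed.

(** The rule for [s (r + 1) = r] is the one for [Q] nonempty read with [Q]
empty: the bracket in which [j] is fixed vanishes, and the empty cycle gives the term
in [C0]. *)
Lemma split_last p : P = rcons p j ->
  (2%:R - C0) * W [:: j :: p] =
  W [:: p; [:: j]] - W [:: j :: p; [::]] + (W [:: j :: p] + W [:: j :: p]).
Proof.
rewrite -cats1 => eP.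
have -> : W [:: p; [:: j]] = 0.
  rewrite /W /bracket (@fixpoint_value_eq0 _ _ j) ?mulr0 //.
  have [||din _] := @merged_perm_spec _ s j [:: p; [:: j]]; last 1 first.
  - by rewrite (din [:: j]) ?inE ?eqxx ?orbT //= eqxx.
  - by rewrite /= -eP uniq_tail.
  - by move=> k; rewrite /= -eP region_tail // eP mem_cat mem_head orbT.
have -> : W [:: j :: p; [::]] = C0 * W [:: j :: p].
  rewrite bracket1 /W /bracket /= expr1; congr (_ * w _).
  rewrite /merged_perm /perm_of_cycles /= !big_cons.
  suff -> : cycle_perm [::] = 1%g :> 'S_n.+1 by rewrite mul1g.
  by apply/permP => k; rewrite cycle_perm_out // perm1.
by rewrite sub0r mulrBl mulr_natl mulr2n addrC.
Qed.

End Corrections.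

Section CycleWords.
Variables (n : nat) (s : 'S_n.+2) (j : 'I_n.+1).
Let t := move_first s (pos0 j).

Lemma cycle_word_pos0 :
  cycle_word t (pos0 j) = pos0 j :: map (lift (pos0 j)) (tail s).
Proof. exact: move_first_orbit. Qed.

Lemma cycle_word_pos1 q : j \notin tail s -> fingraph.orbit (del s) j = j :: q ->
  cycle_word t (pos1 j) = pos1 j :: map (lift (pos0 j)) q.
Proof.
by move=> jP oj; rewrite -move_first_pos1 /cycle_word move_first_orbit_out // oj.
Qed.

Lemma pos1_notin : j \notin tail s -> pos1 j \notin cycle_word t (pos0 j).
Proof.
move=> jP; rewrite cycle_word_pos0 in_cons -move_first_pos1 eq_sym.
by rewrite (negPf (neq_lift _ _)) /= mem_map //; apply: lift_inj.
Qed.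

End CycleWords.

(** * Cyclic invariance *)

Lemma gl_step (A : comNzRingType) (C0 : A) (w : forall m, 'S_m -> A) :
  gl_recurrence C0 w -> forall n (s : 'S_n.+2) j,
  w _ (move_first s (pos0 j)) = w _ (move_first s (pos1 j)) +
    (gl_potential s C0 w j - gl_potential s C0 w (del s j)).
Proof.
move=> rec n s j; have E0 := cycle_word_pos0 s j.
have [jP|jP] := boolP (j \in tail s).
  have [p1 [p2 eP]] := mem_split jP.
  have [_] := rec _ (move_first s (pos0 j)) j
    (map (lift (pos0 j)) p1) (map (lift (pos0 j)) p2).
  rewrite E0 eP map_cat /= move_first_pos1 => /(_ erefl) ->.
  by rewrite swap_move_first !merge_lift_map -addrA (split_bracket _ _ eP).
have [q oj] := orbit_consP (del s) j.
have [+ _] := rec _ (move_first s (pos0 j)) j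
  (map (lift (pos0 j)) (tail s)) (map (lift (pos0 j)) q).
move=> /(_ (pos1_notin jP) E0 (cycle_word_pos1 jP oj)) ->.
by rewrite swap_move_first !merge_lift_map -addrA join_bracket.
Qed.

Lemma so_step (A : comNzRingType) (C0 : A) (w : forall m, 'S_m -> A) :
  (forall x : A, x + x = 0 -> x = 0) ->
  (forall m (t t' : 'S_m) (a : 'I_m), is_cycle_inversion t t' a ->
     w _ t' = (-1) ^+ #|porbit t a| * w _ t) ->
  so_recurrence C0 w -> forall n (s : 'S_n.+2) j,
  let F k := gl_potential s C0 w k + so_potential s w k in
  w _ (move_first s (pos0 j)) = w _ (move_first s (pos1 j)) + (F j - F (del s j)).
Proof.
move=> no2 winv rec n s j F.
have -> : F j - F (del s j) =
    (gl_potential s C0 w j - gl_potential s C0 w (del s j)) +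
    (so_potential s w j - so_potential s w (del s j)).
  by rewrite /F opprD addrACA.
have E0 := cycle_word_pos0 s j.
have [jP|jP] := boolP (j \in tail s).
  have [p1 [p2 eP]] := mem_split jP.
  have [_] := rec _ (move_first s (pos0 j)) j
    (map (lift (pos0 j)) p1) (map (lift (pos0 j)) p2).
  rewrite E0 eP map_cat /= move_first_pos1 swap_move_first => /(_ erefl).
  rewrite !merge_lift_map size_map -(split_bracket _ _ eP) -(split_extra C0 winv eP).
  case: p2 eP => [|y p2] eP; last by move=> /(_ isT) -> _; rewrite -!addrA.
  move=> _ /(_ erefl) ->; rewrite (split_last C0 winv no2); last by rewrite eP cats1.
  by rewrite expr0 mul1r cats0 cat0s.
have [q oj] := orbit_consP (del s) j.
have [+ _ _] := rec _ (move_first s (pos0 j)) j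
  (map (lift (pos0 j)) (tail s)) (map (lift (pos0 j)) q).
move=> /(_ (pos1_notin jP) E0 (cycle_word_pos1 jP oj)) ->.
rewrite swap_move_first !merge_lift_map size_map.
by rewrite -(join_bracket _ _ jP oj) -(join_extra C0 winv jP oj) -!addrA.
Qed.

Lemma lmod_no2tors (K : fieldType) (V : lmodType K) (x : V) :
  (2%:R : K) != 0 -> x + x = 0 -> x = 0.
Proof. by move=> two /eqP; rewrite -mulr2n -scaler_nat scaler_eq0 (negPf two) => /eqP. Qed.

Lemma cpoly_no2tors (R : realType) (x : cpoly R) : x + x = 0 -> x = 0.
Proof.
have two : (2%:R : R[i]) != 0 by rewrite Num.Theory.pnatr_eq0.
exact: (@lmod_no2tors _ {malg R[i][{cmonom nat}]} x two).
Qed.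

(* In MathComp (s ^ c)%g is the permutation sending c x to c (s x), which is
   c s c^-1 for composition of maps written right to left. *)
Theorem theorem2p5 (R : realType) :
  (forall w : (forall m : nat, 'S_m -> cpoly R), is_w_gl w ->
     forall (m : nat) (s : 'S_m), (1 <= m)%N ->
       w m (s ^ std_cycle m)%g = w m s)
  /\
  (forall w : (forall m : nat, 'S_m -> cpoly R), is_w_so w ->
     forall (m : nat) (s : 'S_m), (1 <= m)%N ->
       w m (s ^ std_cycle m)%g = w m s).
Proof.
split=> w.
  case=> _ _ rec; apply: cyclic_invariance => n s.
  by exists (gl_potential s (cvar R 0) w) => j; apply: gl_step rec _ _ _.
case=> _ winv _ rec; apply: cyclic_invariance => n s.
exists (fun k => gl_potential s (cvar R 0) w k + so_potential s w k) => j.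
exact: (so_step (@cpoly_no2tors R) winv rec).
Qed.
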